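(* Let $G$ be a weakly connected and weight-balanced weighted directed graph on $N\ge 2$ nodes with Laplacian matrix $L$, and let $\Delta>0$. Let $x:[0,+\infty)\to\mathbb{R}^N$ be any Krasowskii solution to $\dot x=-L\,\mathtt{q}(x)$, where $\mathtt{q}$ is the uniform quantizer of step $\Delta$. Let $x_{\mathrm{ave}}(0)=N^{-1}\mathbf{1}^*x(0)$ and $$M=\left\{x\in\mathbb{R}^N:\ \frac{1}{\sqrt N}\,\|x-x_{\mathrm{ave}}(0)\mathbf{1}\|\le \frac{\|L\|}{\lambda_2(\mathrm{Sym}(L))}\,\frac{\Delta}{2}\right\}.$$ Then $\mathrm{dist}(x(t),M)\to 0$ as $t\to+\infty$.
   Context: A weighted directed graph $G=(V,E,A)$ has node set $V=\{1,\dots,N\}$, edge set $E\subset V\times V$ without self-loops, and adjacency matrix $A\in\mathbb{R}_{\ge0}^{N\times N}$ with $A_{ij}>0$ if $(j,i)\in E$ and $A_{ij}=0$ otherwise. It is weight-balanced if $\sum_j A_{ij}=\sum_j A_{ji}$ for every $i\in V$; it is weakly connected if any two nodes are joined by a path of edges, disregarding edge orientation. $\mathbf 1\in\mathbb{R}^N$ is the all-ones vector, $L=\mathrm{diag}(A\mathbf 1)-A$ is the Laplacian, $\mathrm{Sym}(L)=\frac{L+L^*}{2}$, where $^*$ denotes conjugate transpose, and $\lambda_2(\mathrm{Sym}(L))$ is the smallest nonzero eigenvalue of $\mathrm{Sym}(L)$ (which is positive semidefinite when $G$ is weakly connected and weight-balanced). $\|\cdot\|$ is the Euclidean norm for vectors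 and the induced norm for matrices; $\mathrm{dist}$ is Euclidean distance to a set. Uniform quantizer: $\mathtt q(r)=\lfloor \frac{r}{\Delta}+\frac12\rfloor\Delta$ for $r\in\mathbb{R}$, applied componentwise to vectors. A Krasowskii solution to $\dot x=-L\mathtt q(x)$ on an interval $I$ is an absolutely continuous function (locally absolutely continuous if $I$ is unbounded) $x:I\to\mathbb{R}^N$ such that $\dot x(t)\in\mathcal K(-L\mathtt q(x(t)))$ for almost every $t\in I$, where $\mathcal K(-L\mathtt q(x))=\bigcap_{\delta>0}\overline{\mathrm{co}}\,\{-L\mathtt q(y): y\in B(x,\delta)\}$, with $B(x,\delta)$ the Euclidean ball of radius $\delta$ centered at $x$ and $\overline{\mathrm{co}}$ the closed convex hull. *)

(* Defs.v *)
From HB Require Import structures.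
From mathcomp Require Import all_boot all_order all_algebra.
From mathcomp Require Import all_classical all_reals all_analysis.

Set Implicit Arguments.
Unset Strict Implicit.
Unset Printing Implicit Defensive.

Import Order.TTheory GRing.Theory Num.Theory.
Import numFieldNormedType.Exports.

Local Open Scope classical_set_scope.
Local Open Scope ring_scope.

(* [edge i j] means (i, j) \in E; following the usual convention for
   Laplacian flows, the weight of (j, i) is stored in entry (i, j) of [adj]. *)
Record wdigraph (R : realType) (N : nat) := WDigraph {
  edge : rel 'I_N;
  adj : 'M[R]_N;
  edge_irr : irreflexive edge;
  adj_gt0 : forall i j, edge j i -> 0 < adj i j;
  adj_eq0 : forall i j, ~~ edge j i -> adj i j = 0
}.

Section Graph.
Context {R : realType} {N : nat}.
Implicit Type G : wdigraph R N.

Definition weight_balanced G : Prop :=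
  forall i, \sum_j adj G i j = \sum_j adj G j i.

Definition weakly_connected G : Prop :=
  forall i j, connect [rel u v | edge G u v || edge G v u] i j.

Definition ones : 'cV[R]_N := const_mx 1.

Definition laplacian G : 'M[R]_N := diag_mx (adj G *m ones)^T - adj G.

(* Over the reals the conjugate transpose is the transpose. *)
Definition Sym (L : 'M[R]_N) : 'M[R]_N := 2^-1 *: (L + L^T).

(* The smallest nonzero eigenvalue of [S]: the infimum is over a finite set,
   so it is attained as soon as [S] has a nonzero eigenvalue. *)
Definition lambda2 (S : 'M[R]_N) : R :=
  inf [set a | eigenvalue S a /\ a != 0].

End Graph.

Section Euclidean.
Context {R : realType} {N : nat}.
Implicit Types (x y : 'cV[R]_N) (S : set 'cV[R]_N).

(* The library norm on matrices is the sup norm; it induces the same topology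
   (hence the same closed sets, limits and derivatives) as this one. *)
Definition enorm x : R := Num.sqrt (\sum_i x i 0 ^+ 2).

Definition opnorm (L : 'M[R]_N) : R :=
  sup [set enorm (L *m x) | x in [set x | enorm x <= 1]].

Definition edistance x S : R := inf [set enorm (x - y) | y in S].

Definition eball x (d : R) : set 'cV[R]_N := [set y | enorm (y - x) < d].

Definition closed_convex_hull S : set 'cV[R]_N :=
  smallest [set C | closed C /\ @convex_set R 'cV[R]_N C] S.

End Euclidean.

Section Krasowskii.
Context {R : realType} {N : nat}.

Definition krasowskii (f : 'cV[R]_N -> 'cV[R]_N) (x : 'cV[R]_N) :
    set 'cV[R]_N :=
  \bigcap_(d in [set d : R | 0 < d]) closed_convex_hull (f @` eball x d).

Definition absolutely_continuous (l u : R) (x : R -> 'cV[R]_N) : Prop :=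
  forall e : R, 0 < e -> exists2 d : R, 0 < d &
    forall (n : nat) (a b : 'I_n -> R),
      (forall i, l <= a i /\ a i <= b i /\ b i <= u) ->
      trivIset [set: 'I_n] (fun i => [set` `]a i, b i[]) ->
      \sum_i (b i - a i) < d ->
      \sum_i enorm (x (b i) - x (a i)) < e.

(* Solutions on [0, +oo[: the values of [x] on negative reals play no role,
   the two-sided derivative at 0 being excluded by the null set. *)
Definition krasowskii_solution (f : 'cV[R]_N -> 'cV[R]_N)
    (x : R -> 'cV[R]_N) : Prop :=
  (forall l u : R, 0 <= l -> l <= u -> absolutely_continuous l u x) /\
  {ae (@lebesgue_measure R), forall t : R, 0 <= t ->
    derivable x t 1 /\ krasowskii f (x t) (derive1 x t)}.

End Krasowskii.

Section Quantizer.
Context {R : realType} {N : nat}.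

Definition quantize (D r : R) : R := (Num.floor (r / D + 2^-1))%:~R * D.

Definition quantizev (D : R) (x : 'cV[R]_N) : 'cV[R]_N :=
  map_mx (quantize D) x.

Definition average (x : 'cV[R]_N) : R := N%:R^-1 * (ones^T *m x) 0 0.

Definition consensus_set (L : 'M[R]_N) (D : R) (x0 : 'cV[R]_N) :
    set 'cV[R]_N :=
  [set x | (Num.sqrt N%:R)^-1 * enorm (x - average x0 *: ones) <=
           opnorm L / lambda2 (Sym L) * (D / 2)].

End Quantizer.

(* Main.v *)
(* With y = x - x_ave(0) 1, every Krasowskii velocity v at x satisfies
   1.v = 0 and y.v <= - lambda_2 |y| (|y| - r), where
   r = sqrt N ||L|| Delta / (2 lambda_2): each of these bounds defines a closed
   half-space, so it is enough to check it on -L q(z) for z close to x, where it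
   follows from |q(z) - z| <= sqrt N Delta / 2, L 1 = 0 and
   y.Ly >= lambda_2 |y|^2 on the hyperplane orthogonal to 1.
   Hence the average is constant and |y|, which is absolutely continuous, has
   derivative at most - lambda_2 e almost everywhere on {|y| > r + e}; so |y|
   drops below r + e in finite time and stays there.  Since M is the ball of
   radius r around x_ave(0) 1, the distance to M is eventually at most e. *)

Require Import Defs.
From mathcomp Require Import all_boot all_order all_algebra.
From mathcomp Require Import all_classical all_reals all_analysis.
From mathcomp Require Import ring lra.
Import Order.TTheory GRing.Theory Num.Theory.
Import numFieldNormedType.Exports.
Local Open Scope classical_set_scope.
Local Open Scope ring_scope.

(** * Euclidean norm and induced norm *)

Section DotProduct.
Context {R : realType} {N : nat}.
Implicit Types (u v w : 'cV[R]_N) (A : 'M[R]_N).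

Definition dot u v : R := (u^T *m v) 0 0.

Lemma dotE u v : dot u v = \sum_i u i 0 * v i 0.
Proof. by rewrite /dot !mxE; apply: eq_bigr => i _; rewrite !mxE. Qed.

Lemma dotC u v : dot u v = dot v u.
Proof. by rewrite !dotE; apply: eq_bigr => i _; rewrite mulrC. Qed.

Lemma dotDr u v w : dot u (v + w) = dot u v + dot u w.
Proof. by rewrite /dot mulmxDr !mxE. Qed.

Lemma dotZr a u v : dot u (a *: v) = a * dot u v.
Proof. by rewrite /dot -scalemxAr !mxE. Qed.

Lemma dotNr u v : dot u (- v) = - dot u v.
Proof. by rewrite -scaleN1r dotZr mulN1r. Qed.

Lemma dotBr u v w : dot u (v - w) = dot u v - dot u w.
Proof. by rewrite dotDr dotNr. Qed.

Lemma dotDl u v w : dot (u + v) w = dot u w + dot v w.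
Proof. by rewrite dotC dotDr !(dotC w). Qed.

Lemma dotZl a u v : dot (a *: u) v = a * dot u v.
Proof. by rewrite dotC dotZr dotC. Qed.

Lemma dotBl u v w : dot (u - v) w = dot u w - dot v w.
Proof. by rewrite dotC dotBr !(dotC w). Qed.

Lemma dot0r u : dot u 0 = 0.
Proof. by rewrite /dot mulmx0 mxE. Qed.

Lemma dot_mulmx A u v : dot u (A *m v) = dot (A^T *m u) v.
Proof. by rewrite /dot trmx_mul trmxK mulmxA. Qed.

Lemma dot_ge0 u : 0 <= dot u u.
Proof. by rewrite dotE sumr_ge0 // => i _; rewrite -expr2 sqr_ge0. Qed.

Lemma dot_eq0 u : (dot u u == 0) = (u == 0).
Proof.
apply/idP/eqP => [|->]; last by rewrite dot0r.
rewrite dotE psumr_eq0 => [/allP u0|i _]; last by rewrite -expr2 sqr_ge0.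
apply/matrixP => i j; rewrite ord1 mxE.
by have /eqP := u0 i (mem_index_enum i); rewrite -expr2 => /eqP; rewrite sqrf_eq0 => /eqP.
Qed.

Lemma enormE u : enorm u = Num.sqrt (dot u u).
Proof. by rewrite /enorm dotE; under eq_bigr do rewrite expr2. Qed.

Lemma enorm_ge0 u : 0 <= enorm u.
Proof. exact: sqrtr_ge0. Qed.

Lemma enorm_sqr u : enorm u ^+ 2 = dot u u.
Proof. by rewrite enormE sqr_sqrtr ?dot_ge0. Qed.

Lemma enorm_eq0 u : (enorm u == 0) = (u == 0).
Proof. by rewrite -sqrf_eq0 enorm_sqr dot_eq0. Qed.

Lemma enorm0 : enorm (0 : 'cV[R]_N) = 0.
Proof. by apply/eqP; rewrite enorm_eq0. Qed.

Lemma enormZ a u : enorm (a *: u) = `|a| * enorm u.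
Proof.
by rewrite enormE dotZl dotZr mulrA -expr2 sqrtrM ?sqr_ge0// sqrtr_sqr enormE.
Qed.

Lemma enormN u : enorm (- u) = enorm u.
Proof. by rewrite -scaleN1r enormZ normrN1 mul1r. Qed.

(** With [w = dot v v *: u - dot u v *: v], the inequality [0 <= dot w w] is the squared claim
    multiplied by [dot v v]. *)
Lemma cauchy_schwarz u v : dot u v <= enorm u * enorm v.
Proof.
have [->|v0] := eqVneq v 0; first by rewrite dot0r enorm0 mulr0.
apply: le_trans (ler_norm _) _.
rewrite -(@ler_pXn2r _ 2)// ?nnegrE ?mulr_ge0 ?enorm_ge0//.
rewrite real_normK ?num_real// exprMn !enorm_sqr.
have vv : 0 < dot v v by rewrite lt_def dot_eq0 v0 dot_ge0.
suff : 0 <= dot v v * (dot u u * dot v v - dot u v ^+ 2).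
  by rewrite pmulr_rge0// subr_ge0.
apply: le_trans (dot_ge0 (dot v v *: u - dot u v *: v)) _.
rewrite !(dotBl, dotBr, dotZl, dotZr) (dotC v u) le_eqVlt; apply/orP; left.
apply/eqP; ring.
Qed.

Lemma enormD u v : enorm (u + v) <= enorm u + enorm v.
Proof.
rewrite -(@ler_pXn2r _ 2)// ?nnegrE ?addr_ge0 ?enorm_ge0//.
rewrite sqrrD !enorm_sqr dotDl !dotDr (dotC v u).
by have := cauchy_schwarz u v; rewrite mulr2n; lra.
Qed.

Lemma enorm_distl u v : `|enorm u - enorm v| <= enorm (u - v).
Proof.
rewrite ler_distlC.
have := enormD (u - v) v; have := enormD (v - u) u.
by rewrite !subrK -(enormN (v - u)) opprB => ? ?; apply/andP; split; lra.
Qed.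

Lemma coord_enorm u i : `|u i 0| <= enorm u.
Proof.
rewrite -(@ler_pXn2r _ 2)// ?nnegrE ?enorm_ge0//.
rewrite enorm_sqr dotE real_normK ?num_real// (bigD1 i)//= -expr2 lerDl.
by rewrite sumr_ge0 // => j _; rewrite -expr2 sqr_ge0.
Qed.

(** This comparison with the sup norm is the source of the factor [Num.sqrt N%:R] in the
    quantization error. *)
Lemma enorm_le_coord u (c : R) : 0 <= c -> (forall i, `|u i 0| <= c) ->
  enorm u <= Num.sqrt N%:R * c.
Proof.
move=> c0 uc; rewrite -(@ler_pXn2r _ 2)// ?nnegrE ?mulr_ge0 ?sqrtr_ge0//.
rewrite exprMn enorm_sqr (sqr_sqrtr (ler0n _ _)) dotE.
apply: (@le_trans _ _ (\sum_(i < N) c ^+ 2)).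
  apply: ler_sum => i _; rewrite -expr2 -real_normK ?num_real//.
  by rewrite ler_pXn2r ?nnegrE.
by rewrite sumr_const card_ord mulr_natl.
Qed.

(** A crude bound suffices to make the supremum in [opnorm] meaningful: on the unit ball each
    coordinate of [A *m x] is at most the sum of all [|A i j|]. *)
Lemma opnorm_has_sup A : has_sup [set enorm (A *m x) | x in [set x | enorm x <= 1]].
Proof.
split.
  by exists (enorm (A *m 0)); exists 0 => //=; rewrite enorm0.
have c0 : 0 <= \sum_i \sum_j `|A i j|.
  by rewrite sumr_ge0// => i _; rewrite sumr_ge0.
exists (Num.sqrt N%:R * \sum_i \sum_j `|A i j|) => _ [x /= x1 <-].
apply: enorm_le_coord => // i; rewrite mxE [leRHS](bigD1 i)//=.
apply: le_trans (ler_norm_sum _ _ _) _.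
rewrite -[leLHS]addr0 lerD//; last by rewrite sumr_ge0// => k _; rewrite sumr_ge0.
apply: ler_sum => j _; rewrite normrM ler_piMr//.
exact: le_trans (coord_enorm _ _) x1.
Qed.

Lemma enorm_mulmx A u : enorm (A *m u) <= opnorm A * enorm u.
Proof.
have [->|u0] := eqVneq u 0; first by rewrite mulmx0 enorm0 mulr0.
have nu : 0 < enorm u by rewrite lt_def enorm_eq0 u0 enorm_ge0.
rewrite -ler_pdivrMr//.
have -> : enorm (A *m u) / enorm u = enorm (A *m ((enorm u)^-1 *: u)).
  by rewrite -scalemxAr enormZ ger0_norm ?invr_ge0 ?enorm_ge0// mulrC.
apply: ub_le_sup; first by have [] := opnorm_has_sup A.
exists ((enorm u)^-1 *: u) => //=.
by rewrite enormZ ger0_norm ?invr_ge0 ?enorm_ge0// mulVf// gt_eqF.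
Qed.

Lemma opnorm_ge0 A : 0 <= opnorm A.
Proof.
apply: ub_le_sup; first by have [] := opnorm_has_sup A.
by exists 0; rewrite /= ?mulmx0 enorm0.
Qed.

End DotProduct.

(** * Smallest nonzero eigenvalue of a positive semidefinite matrix *)

Section Rayleigh.
Context {R : realType} {N : nat}.
Implicit Types (u v e y z : 'cV[R]_N) (S : 'M[R]_N).

Lemma continuous_sum (T : topologicalType) n (f : 'I_n -> T -> R) :
  (forall i, continuous (f i)) -> continuous (fun x => \sum_i f i x).
Proof.
move=> fc; rewrite (_ : (fun _ => _) = \sum_i f i); last first.
  by apply/funext => x; rewrite fct_sumE.
apply: (big_ind (fun g : T -> R => continuous g)) => // [|g h gc hc] x.
- exact: cvg_cst.
- by apply: continuousD; [exact: gc|exact: hc].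
Qed.

Lemma continuous_dot u : continuous (dot u).
Proof.
rewrite (_ : dot u = fun v => \sum_i u i 0 * v i 0).
  apply: continuous_sum => i v; apply: continuousM; [exact: cst_continuous|].
  exact: coord_continuous.
by apply/funext => v; rewrite dotE.
Qed.

Lemma continuous_dot_tr u : continuous (fun v : 'rV[R]_N => dot u v^T).
Proof.
rewrite (_ : (fun _ => _) = fun v : 'rV[R]_N => \sum_i u i 0 * v 0 i).
  apply: continuous_sum => i v; apply: continuousM; [exact: cst_continuous|].
  exact: coord_continuous.
by apply/funext => v; rewrite dotE; under eq_bigr do rewrite mxE.
Qed.

Lemma continuous_quad S :
  continuous (fun v : 'rV[R]_N => dot v^T (S *m v^T)).
Proof.
rewrite (_ : (fun _ => _) =
  fun v : 'rV[R]_N => \sum_i v 0 i * dot (row i S)^T v^T).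
  apply: continuous_sum => i v.
  have vi : {for v, continuous (fun v : 'rV[R]_N => v 0 i)} by exact: coord_continuous.
  have Sv : {for v, continuous (fun v : 'rV[R]_N => dot (row i S)^T v^T)}.
    exact: continuous_dot_tr.
  exact: continuousM vi Sv.
apply/funext => v; rewrite dotE; apply: eq_bigr => i _; rewrite mxE dotE mxE.
by congr (_ * _); apply: eq_bigr => j _; rewrite !mxE.
Qed.

(** The quadratic form attains its minimum [m] on the unit sphere of the hyperplane orthogonal to
    [e], which is compact, and nonempty thanks to [y]; homogeneity extends the bound to the whole
    hyperplane. *)
Lemma rayleigh_min S e y : y != 0 -> dot e y = 0 ->
  exists m, (forall z, dot e z = 0 -> m * dot z z <= dot z (S *m z)) /\
   exists2 y0, y0 != 0 & dot e y0 = 0 /\ dot y0 (S *m y0) = m * dot y0 y0.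
Proof.
move=> y0 ey.
have norm1 z : z != 0 -> dot ((enorm z)^-1 *: z) ((enorm z)^-1 *: z) = 1.
  move=> z0; rewrite dotZl dotZr mulrA -expr2 -enorm_sqr -exprMn mulVf ?expr1n//.
  by rewrite enorm_eq0.
(* The identity matrix is inserted so that the unit sphere is a fiber of a form covered by
   [continuous_quad]. *)
pose A := [set v : 'rV[R]_N | dot v^T (1%:M *m v^T) = 1] `&` [set v | dot e v^T = 0].
have A0 : A !=set0.
  exists ((enorm y)^-1 *: y)^T; split => /=; rewrite trmxK ?mul1mx ?norm1//.
  by rewrite dotZr ey mulr0.
have closed_fiber (f : 'rV[R]_N -> R) (a : R) : continuous f -> closed [set v | f v = a].
  by move=> fc; apply: (@preimage_closed _ _ f [set a]) => [v _|]; [exact: fc|exact: closed_eq].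
have Acl : closed A.
  apply: closedI; apply: closed_fiber; first exact: continuous_quad.
  exact: continuous_dot_tr.
have Ac : compact A.
  have box : compact [set v : 'rV[R]_N | forall i, `[(-1 : R), 1]%classic (v ord0 i)].
    apply: (@rV_compact _ _ (fun=> `[(-1 : R), 1]%classic)) => _.
    exact: segment_compact.
  apply: subclosed_compact Acl box _ => v [/= v1 _] i.
  have := coord_enorm v^T i.
  rewrite mul1mx in v1.
  by rewrite enormE v1 sqrtr1 mxE ler_norml in_itv.
have [c] := EVT_min_rV A0 Ac (continuous_subspaceT (@continuous_quad S)).
rewrite inE => -[/= c1 ec] cmin; rewrite mul1mx in c1.
exists (dot c^T (S *m c^T)); split=> [z ez|].
  have [->|z0] := eqVneq z 0; first by rewrite mulmx0 !dot0r mulr0.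
  have := cmin ((enorm z)^-1 *: z)^T; rewrite inE /A /= !trmxK mul1mx norm1//.
  rewrite dotZr ez mulr0 => /(_ (conj erefl erefl)).
  rewrite -scalemxAr dotZl dotZr mulrA -enorm_sqr -invfM -expr2 mulrC ler_pdivlMr//.
  by rewrite exprn_gt0// lt_def enorm_eq0 z0 enorm_ge0.
exists c^T; last by rewrite c1 mulr1.
by rewrite -dot_eq0 c1 oner_eq0.
Qed.

(** The minimum [m] of the Rayleigh quotient on the hyperplane is positive and is itself an
    eigenvalue. Conversely, an eigenvector for a nonzero eigenvalue is orthogonal to [e], because
    the range of [S] is, so its eigenvalue is at least [m]. *)
Lemma lambda2_spec S e y : S^T = S -> S *m e = 0 -> y != 0 -> dot e y = 0 ->
  (forall z, dot e z = 0 -> z != 0 -> 0 < dot z (S *m z)) ->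
  0 < lambda2 S /\
  forall z, dot e z = 0 -> lambda2 S * dot z z <= dot z (S *m z).
Proof.
move=> Ssym Se y0 ey Spos.
have [m [mle [c c0 [ec cm]]]] := rayleigh_min S e y y0 ey.
have m0 : 0 < m.
  by rewrite -(pmulr_lgt0 _ (_ : 0 < dot c c)) -?cm ?Spos// lt_def dot_eq0 c0 dot_ge0.
have eS z : dot e (S *m z) = 0 by rewrite dot_mulmx Ssym Se dotC dot0r.
(* The Rayleigh quotient is stationary at [c] along the hyperplane orthogonal
   to [e], and the gradient lies in that hyperplane. *)
have Sc : S *m c = m *: c.
  apply/eqP; rewrite -subr_eq0; set w := _ - _.
  have ew : dot e w = 0 by rewrite dotBr dotZr eS ec mulr0 subr0.
  have cw : dot c (S *m w) - m * dot c w = dot w w.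
    by rewrite dot_mulmx Ssym -dotZl -dotBl.
  have wc : dot w (S *m c) - m * dot w c = dot w w.
    by rewrite -dotZr -dotBr.
  clearbody w; apply: contraT => w0.
  have ww : 0 < dot w w by rewrite lt_def dot_eq0 w0 dot_ge0.
  set q := dot w (S *m w) - m * dot w w.
  have H t : 0 <= 2 * t * dot w w + t ^+ 2 * q.
    have := mle (c + t *: w); rewrite dotDr dotZr ec ew mulr0 addr0 => /(_ erefl).
    rewrite mulmxDr -scalemxAr !(dotDl, dotDr, dotZl, dotZr) cm -subr_ge0.
    have -> : dot c (S *m w) = dot w w + m * dot c w by rewrite -cw subrK.
    have -> : dot w (S *m c) = dot w w + m * dot w c by rewrite -wc subrK.
    by congr (_ <= _); rewrite /q; ring.
  have q0 : 0 <= q.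
    by rewrite /q subr_ge0 mle.
  (* At this [t] the quadratic polynomial in [H] is strictly negative; the [+ 1] keeps the
     denominator positive when [q = 0]. *)
  have := H (- (dot w w / (q + 1))); rewrite sqrrN => H'.
  have q1 : 0 < q + 1 by lra.
  have : 0 <= - (dot w w / (q + 1)) * dot w w * (q + 2) / (q + 1).
    apply: le_trans H' _; rewrite le_eqVlt; apply/orP; left; apply/eqP.
    by field; rewrite gt_eqF.
  rewrite leNgt => /negP[]; rewrite !mulNr oppr_lt0.
  by rewrite !mulr_gt0 ?invr_gt0//; lra.
have eigm : [set a | eigenvalue S a /\ a != 0] m.
  split=> /=; last by rewrite gt_eqF.
  (* [eigenvalue] speaks of row vectors, so the symmetry of [S] is what turns [c] into an
     eigenvector in that sense. *)
  apply/eigenvalueP; exists c^T; last by rewrite -(inj_eq trmx_inj) trmx0 trmxK.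
  by apply: trmx_inj; rewrite trmx_mul trmxK Ssym Sc linearZ /= trmxK.
have mlb : lbound [set a | eigenvalue S a /\ a != 0] m.
  move=> a [/= /eigenvalueP[v vS v0] a0].
  have Sv : S *m v^T = a *: v^T by rewrite -{1}Ssym -trmx_mul vS linearZ.
  have ev : dot e v^T = 0.
    have : dot e (S *m v^T) = 0 by exact: eS.
    by rewrite Sv dotZr => /eqP; rewrite mulf_eq0 (negPf a0) => /eqP.
  have := mle _ ev; rewrite Sv dotZr ler_pM2r// lt_def dot_ge0 dot_eq0.
  by rewrite -(inj_eq trmx_inj) trmx0 trmxK v0.
have -> : lambda2 S = m.
  apply/eqP; rewrite eq_le; apply/andP; split.
    by apply: ge_inf => //; exists m.
  by apply: lb_le_inf => //; exists m.
by [].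
Qed.

End Rayleigh.

(** * Laplacian of a weight-balanced digraph *)

Section LaplacianForm.
Context {R : realType} {N : nat} (G : wdigraph R N).
Hypothesis hbal : weight_balanced G.
Implicit Types y : 'cV[R]_N.
Local Notation L := (laplacian G).

Lemma laplacian_mulE y i : (L *m y) i 0 = \sum_j adj G i j * (y i 0 - y j 0).
Proof.
rewrite /laplacian mulmxBl !mxE.
under [RHS]eq_bigr do rewrite mulrBr.
rewrite sumrB; congr (_ - _); rewrite -mulr_suml.
rewrite (bigD1 i)//= big1 ?addr0 => [|j ji]; last first.
  by rewrite !mxE eq_sym (negPf ji) mulr0n mul0r.
rewrite !mxE eqxx mulr1n; congr (_ * _).
by apply: eq_bigr => j _; rewrite !mxE mulr1.
Qed.

Lemma laplacian_ones : L *m ones = 0.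
Proof.
apply/matrixP => i j; rewrite ord1 laplacian_mulE [RHS]mxE big1// => k _.
by rewrite !mxE subrr mulr0.
Qed.

Lemma dot_laplacian y z : dot z (L *m y) =
  \sum_i \sum_j adj G i j * (z i 0 * (y i 0 - y j 0)).
Proof.
rewrite dotE; apply: eq_bigr => i _; rewrite laplacian_mulE mulr_sumr.
by apply: eq_bigr => j _; rewrite mulrCA.
Qed.

(** Each [f i] is multiplied by its row sum minus its column sum, which weight balance cancels. *)
Lemma sum_adj_diff (f : 'I_N -> R) : \sum_i \sum_j adj G i j * (f i - f j) = 0.
Proof.
under eq_bigr do under eq_bigr do rewrite mulrBr.
under eq_bigr do rewrite sumrB.
rewrite sumrB [X in _ - X]exchange_big /= -sumrB big1// => i _.
by rewrite -!mulr_suml hbal subrr.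
Qed.

Lemma dot_ones_laplacian y : dot ones (L *m y) = 0.
Proof.
rewrite dot_laplacian -[RHS](sum_adj_diff (fun i => y i 0)).
by apply: eq_bigr => i _; apply: eq_bigr => j _; rewrite mxE mul1r.
Qed.

(** The squared norm of [L^T *m ones] is [dot ones (L *m (L^T *m ones))], an instance of
    [dot_ones_laplacian]. *)
Lemma tr_laplacian_ones : L^T *m ones = 0.
Proof. by apply/eqP; rewrite -dot_eq0 -dot_mulmx dot_ones_laplacian. Qed.

(** Termwise, [2 a (a - b) = (a - b)^2 + (a^2 - b^2)], and the differences of squares sum to zero by
    weight balance. *)
Lemma laplacian_form y :
  dot y (L *m y) = 2^-1 * \sum_i \sum_j adj G i j * (y i 0 - y j 0) ^+ 2.
Proof.
have y2 := sum_adj_diff (fun i => y i 0 ^+ 2).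
transitivity (2^-1 * (\sum_i \sum_j adj G i j * (y i 0 - y j 0) ^+ 2 +
  \sum_i \sum_j adj G i j * (y i 0 ^+ 2 - y j 0 ^+ 2))); last by rewrite y2 addr0.
rewrite -big_split dot_laplacian mulr_sumr.
apply: eq_bigr => i _; rewrite /= -big_split mulr_sumr.
by apply: eq_bigr => j _ /=; field.
Qed.

Lemma dot_Sym (A : 'M[R]_N) y : dot y (Sym A *m y) = dot y (A *m y).
Proof.
rewrite /Sym -scalemxAl mulmxDl dotZr dotDr (dot_mulmx A^T) trmxK [dot (A *m y) y]dotC.
by field.
Qed.

(** If the sum of squares vanishes, [y] takes equal values at the two ends of every edge, so it is
    constant by connectivity; being orthogonal to [ones], it is zero. *)
Lemma laplacian_form_gt0 y : weakly_connected G ->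
  dot ones y = 0 -> y != 0 -> 0 < dot y (L *m y).
Proof.
move=> hconn y1 y0.
have A0 i j : 0 <= adj G i j.
  by have [/adj_gt0/ltW//|/adj_eq0->//] := boolP (edge G j i).
have term0 i j : 0 <= adj G i j * (y i 0 - y j 0) ^+ 2.
  by rewrite mulr_ge0// sqr_ge0.
rewrite lt_def laplacian_form mulr_ge0 ?invr_ge0// ?andbT; last first.
  by rewrite sumr_ge0// => i _; rewrite sumr_ge0.
rewrite mulf_eq0 invr_eq0 pnatr_eq0 /=; apply: contra y0.
rewrite psumr_eq0 => [/allP sum0|i _]; last by rewrite sumr_ge0.
have edge_eq i j : edge G j i -> y i 0 = y j 0.
  move=> ji; have := sum0 i (mem_index_enum i); rewrite psumr_eq0//.
  move=> /allP/(_ j (mem_index_enum j)).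
  by rewrite mulf_eq0 gt_eqF ?adj_gt0//= sqrf_eq0 subr_eq0 => /eqP.
have const i j : y i 0 = y j 0.
  have /connectP[p] := hconn i j.
  elim: p i => [i _ ->//|k p IH i /=] /andP[/orP[ik|ki] kp] jE.
    by rewrite -(edge_eq _ _ ik) (IH k).
  by rewrite (edge_eq _ _ ki) (IH k).
apply/eqP/matrixP => i j; rewrite ord1 mxE.
move: y1; rewrite dotE (eq_bigr (fun=> y i 0)) => [|k _]; last first.
  by rewrite mxE mul1r (const k i).
rewrite sumr_const card_ord => /eqP; rewrite mulrn_eq0 => /orP[|/eqP//].
by rewrite (gtn_eqF (leq_ltn_trans (leq0n i) (ltn_ord i))).
Qed.

Lemma lambda2_laplacian : (2 <= N)%N -> weakly_connected G ->
  0 < lambda2 (Sym L) /\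
  forall y, dot ones y = 0 -> lambda2 (Sym L) * dot y y <= dot y (L *m y).
Proof.
move=> hN hconn.
pose i0 : 'I_N := Ordinal (ltn_trans (ltnSn 0) hN).
pose i1 : 'I_N := Ordinal hN.
(* Two distinct nodes provide the nonzero vector orthogonal to [ones] that [lambda2_spec] asks
   for. *)
pose y : 'cV[R]_N := delta_mx i0 0 - delta_mx i1 0.
have dot_delta i : dot ones (delta_mx i 0 : 'cV[R]_N) = 1.
  rewrite dotE (bigD1 i)//= big1 => [|j ji].
    by rewrite !mxE !eqxx mulr1 addr0.
  by rewrite !mxE (negPf ji) mulr0.
have y0 : y != 0.
  apply/eqP => /matrixP/(_ i0 0); rewrite !mxE !eqxx /= subr0 => /eqP.
  by rewrite oner_eq0.
have SE z := dot_Sym L z.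
have [] := @lambda2_spec _ _ (Sym L) ones y _ _ y0.
- by rewrite /Sym linearZ /= linearD /= trmxK addrC.
- by rewrite /Sym -scalemxAl mulmxDl laplacian_ones tr_laplacian_ones addr0 scaler0.
- by rewrite /y dotBr !dot_delta subrr.
- by move=> z z1 z0; rewrite SE laplacian_form_gt0.
- by move=> l0 lle; split=> // z z1; rewrite -SE lle.
Qed.

End LaplacianForm.

(** * Absolutely continuous functions with bounded derivative *)

Section AbsolutelyContinuous.
Context {R : realType}.
Implicit Types (f : R -> R) (P : R -> Prop).
Local Notation mu := (@lebesgue_measure R).

(** The supremum of the points of [[a, b]] satisfying [P] can be stepped over: [P] passes from a
    point just below it to one just above, unless [b] is already reached. *)
Lemma interval_induction P (a b : R) : a <= b -> P a ->
  (forall t, a <= t -> t <= b -> exists2 r, 0 < r & forall s v,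
    t - r < s -> s <= t -> t <= v -> v < t + r -> a <= s -> v <= b -> P s -> P v) ->
  P b.
Proof.
move=> ab Pa step.
pose S := [set s | a <= s /\ s <= b /\ P s].
have Sa : S a by split.
have Sb : ubound S b by move=> s [_ []].
have supS : has_sup S by split; [exists a|exists b].
have aS : a <= sup S by apply: ub_le_sup Sa; exists b.
have Sleb : sup S <= b by apply: ge_sup => //; exists a.
have [r r0 rstep] := step _ aS Sleb.
have [s [as_ [sb Ps]] ss] := sup_adherent r0 supS.
have s_le : s <= sup S by apply: ub_le_sup => //; exists b.
pose v := Num.min b (sup S + r / 2).
have vS : sup S <= v by rewrite le_min Sleb; lra.
have vb : v <= b by rewrite ge_min lexx.
have vr : v < sup S + r by rewrite gt_min; apply/orP; right; lra.
have Pv : P v by apply: rstep Ps.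
have vS' : v <= sup S.
  by apply: ub_le_sup; [exists b|split=> //; apply: le_trans vS].
suff <- : v = b by [].
have : ~~ (sup S + r / 2 <= sup S) by rewrite -ltNge; lra.
by move: vS'; rewrite /v ge_min => /orP[bS|->]// _; apply: min_l; lra.
Qed.

(** This is the straddle lemma: the increment is split at [t], and each half is compared with the
    derivative at [t]. *)
Lemma derivable_local_slope f (t K e : R) : derivable f t 1 -> derive1 f t <= K -> 0 < e ->
  exists2 r, 0 < r & forall s v, t - r < s -> s <= t -> t <= v -> v < t + r ->
    f v - f s <= (K + e) * (v - s).
Proof.
move=> df fK e0; rewrite derive1E in fK.
have /cvgrPdist_le/(_ e e0) := df.
rewrite near_withinE => /nbhs_ballP[r /= r0 rball].
have slope h : `|h| < r -> h != 0 -> h^-1 * (f (h + t) - f t) <= K + e.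
  move=> hr h0; have := rball h; rewrite -ball_normE /= sub0r normrN => /(_ hr h0).
  rewrite ler_distl => /andP[+ _]; rewrite [h *: 1]mulr1 => hle.
  have : h^-1 * (f (h + t) - f t) - e <= derive f t 1 := hle.
  lra.
exists r => // s v rs st tv vr.
have right : f v - f t <= (K + e) * (v - t).
  have [->|vt] := eqVneq v t; first by rewrite !subrr mulr0.
  have := slope (v - t); rewrite subrK subr_eq0 => H.
  have vt0 : 0 < v - t by rewrite subr_gt0 lt_neqAle eq_sym vt.
  have := H _ vt; rewrite gtr0_norm// mulrC ler_pdivrMr//; apply; lra.
have left_ : f t - f s <= (K + e) * (t - s).
  have [->|vt] := eqVneq s t; first by rewrite !subrr mulr0.
  have := slope (s - t); rewrite subrK subr_eq0 => H.
  have vt0 : 0 < t - s by rewrite subr_gt0 lt_neqAle vt.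
  have := H _ vt; rewrite distrC gtr0_norm// -(opprB t s) invrN mulNr -mulrN opprB.
  rewrite mulrC ler_pdivrMr//; apply; lra.
by have := lerD right left_; rewrite -mulrDr; congr (_ <= _ * _); ring.
Qed.

Definition ac_on f (a b : R) : Prop :=
  forall e : R, 0 < e -> exists2 d : R, 0 < d &
    forall (n : nat) (A B : 'I_n -> R),
      (forall i, a <= A i /\ A i <= B i /\ B i <= b) ->
      trivIset [set: 'I_n] (fun i => [set` `]A i, B i[]) ->
      \sum_i (B i - A i) < d ->
      \sum_i `|f (B i) - f (A i)| < e.

(* [U] is an open cover of small measure of the exceptional null set.  The
   intervals collected are those around points of [U]; on the others [f]
   decreases, so that they can be dropped from the telescoping sum. *)
Lemma cousin_null_cover f (a b : R) (U : set R) : a <= b -> open U ->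
  (forall t, a <= t -> t <= b -> ~ U t -> exists2 r, 0 < r &
     forall s v, t - r < s -> s <= t -> t <= v -> v < t + r -> f v <= f s) ->
  exists n (A B : 'I_n -> R),
    [/\ forall i, a <= A i /\ A i <= B i /\ B i <= b,
        trivIset [set: 'I_n] (fun i => [set` `]A i, B i[]),
        ((\sum_i (B i - A i))%:E <= mu U)%E &
        f b - f a <= \sum_i (f (B i) - f (A i))].
Proof.
move=> ab oU good.
have mU : measurable U by exact: measurable_realfun.open_measurable.
(* Only the part of [U] inside []a, s]] is charged, so that the length bound stays additive when an
   interval starting at [s] is appended. *)
pose P s := exists n (A B : 'I_n -> R),
    [/\ forall i, a <= A i /\ A i <= B i /\ B i <= s,
        trivIset [set: 'I_n] (fun i => [set` `]A i, B i[]),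
        ((\sum_i (B i - A i))%:E <= mu (U `&` `]a, s]))%E &
        f s - f a <= \sum_i (f (B i) - f (A i))].
have : P b.
  apply: (@interval_induction P a b) => // [|t at_ tb].
    exists 0%N, (fun=> 0), (fun=> 0); split.
    - by case.
    - by case.
    - by rewrite big_ord0.
    - by rewrite big_ord0 subrr.
  have [Ut|nUt] := pselect (U t); last first.
    have [r r0 rgood] := good _ at_ tb nUt.
    exists r => // s v rs st tv vr as_ vb [n [A [B [AB tr len fs]]]].
    exists n, A, B; split=> //.
    - move=> i; have [? [? ?]] := AB i; split=> //; split=> //; lra.
    - apply: le_trans len _; apply: le_measure; rewrite ?inE; try exact: measurableI.
      apply: setIS => x /=; rewrite !in_itv/= => /andP[-> xs]; lra.
    - have := rgood s v rs st tv vr; lra.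
  have : nbhs t U by apply: open_nbhs_nbhs.
  move=> /nbhs_ballP[r /= r0]; rewrite -ball_normE /= => rball.
  exists r => // s v rs st tv vr as_ vb [n [A [B [AB tr len fs]]]].
  have sv : s <= v by exact: le_trans tv.
  have svU : [set` `]s, v[] `<=` U.
    move=> x; rewrite /= in_itv /= => /andP[sx xv]; apply: rball => /=.
    by rewrite ltr_distl; apply/andP; split; lra.
  (* The new interval []s, v[] gets index [ord0]; the former ones, all ending by [s], are
     shifted. *)
  exists n.+1, (fun i => oapp A s (unlift ord0 i)), (fun i => oapp B v (unlift ord0 i)).
  split.
  - move=> i; case: unliftP => [j|] _ /=; last by [].
    by have [? [? ?]] := AB j; split=> //; split=> //; lra.
  - move=> i j _ _; case: unliftP => [i'|] -> /=; case: unliftP => [j'|] -> //= [x].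
    + by move=> xij; rewrite (tr i' j')//; exists x.
    + move=> []; rewrite /= !in_itv/= => /andP[_ xB] /andP[sx _].
      by exfalso; have [_ [_ ?]] := AB i'; lra.
    + move=> []; rewrite /= !in_itv/= => /andP[sx _] /andP[_ xB].
      by exfalso; have [_ [_ ?]] := AB j'; lra.
  - rewrite big_ord_recl /= unlift_none /=; under eq_bigr do rewrite liftK /=.
    rewrite EFinD.
    have <- : mu [set` `]s, v[] = (v - s)%:E.
      rewrite lebesgue_measure_itv /= lte_fin.
      by move: sv; rewrite le_eqVlt => /orP[/eqP->|->//]; rewrite ltxx subrr.
    apply: le_trans (leeD (lexx _) len) _.
    rewrite -measureU //; last 2 first.
    + exact: measurableI.
    + apply/seteqP; split=> x //=; rewrite !in_itv/=.
      by move=> [/andP[sx _] [_ /andP[_ xs]]]; lra.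
    apply: le_measure; rewrite ?inE.
    + by apply: measurableU => //; exact: measurableI.
    + exact: measurableI.
    + move=> x [xsv|[Ux]] /=; rewrite ?in_itv/=.
        split; first exact: svU.
        by move: xsv; rewrite /= !in_itv/= => /andP[? ?]; apply/andP; split; lra.
      by move=> /andP[? ?]; split=> //; apply/andP; split; lra.
  - rewrite big_ord_recl /= unlift_none /=; under eq_bigr do rewrite liftK /=.
    lra.
move=> [n [A [B [AB tr len fs]]]]; exists n, A, B; split=> //.
apply: le_trans len _; apply: le_measure; rewrite ?inE//; exact: measurableI.
Qed.

(** The covering lemma is applied to [f t - c * t] with [c] slightly above [K], which decreases
    locally around every point outside [U]. The error splits into three parts of size [e / 3]: the
    variation of [f] on the collected intervals, the linear term on them, and the excess of [c] over
    [K]. *)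
Lemma ac_on_derive_le f (a b K : R) : a <= b -> ac_on f a b ->
  {ae mu, forall t, a <= t -> t <= b -> derivable f t 1 /\ derive1 f t <= K} ->
  f b - f a <= K * (b - a).
Proof.
move=> ab acf [Z [mZ Z0 Zbad]].
apply/ler_addgt0Pr => e e0.
have e30 : 0 < e / 3 by rewrite divr_gt0.
have [d d0 fd] := acf _ e30.
have ba : 0 < b - a + 1 by lra.
(* The [+ 1] avoids a division by zero when [a = b]. *)
pose k := e / 3 / (b - a + 1).
have k0 : 0 < k by rewrite divr_gt0.
pose c := K + k.
have c1 : 0 < `|c| + 1 by rewrite ltr_wpDl.
(* The first bound on the total length controls the variation of [f], the second the linear term. *)
pose d' := Num.min d (e / 3 / (`|c| + 1)).
have d'0 : 0 < d' by rewrite lt_min d0 divr_gt0.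
have [U [oU ZU mUZ]] : exists U : set R, [/\ open U, Z `<=` U & (mu (U `\` Z) < d'%:E)%E].
  have Zoo : (mu Z < +oo)%E by have -> : mu Z = 0%E by []; rewrite ltry.
  exact: lebesgue_regularity_outer mZ Zoo d'0.
have mU : (mu U < d'%:E)%E.
  have mUm : measurable U by exact: measurable_realfun.open_measurable.
  rewrite (_ : U = (U `\` Z) `|` Z); last by rewrite setUC setDUK.
  by rewrite measureU0 //; exact: measurableD.
have [|n [A [B [AB tr len fs]]]] := @cousin_null_cover (fun t => f t - c * t) a b U ab oU.
  move=> t at_ tb nUt.
  have [df fK] : derivable f t 1 /\ derive1 f t <= K.
    by apply: contrapT => bad; apply/nUt/ZU/Zbad => /(_ at_ tb).
  have [r r0 slope] := derivable_local_slope f t K k df fK k0.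
  exists r => // s v rs st tv vr; have := slope _ _ rs st tv vr.
  by rewrite -/c mulrBr; lra.
have sumAB : \sum_i (B i - A i) < d' by rewrite -lte_fin (le_lt_trans len).
have := fd n A B AB tr; rewrite lt_min in sumAB; move/andP: sumAB => [sd sc] /(_ sd) sf.
have H : \sum_i (f (B i) - c * B i - (f (A i) - c * A i)) <=
    \sum_i `|f (B i) - f (A i)| + `|c| * \sum_i (B i - A i).
  rewrite mulr_sumr -big_split ler_sum//= => i _.
  have -> : f (B i) - c * B i - (f (A i) - c * A i) =
     (f (B i) - f (A i)) + (- c) * (B i - A i) by ring.
  rewrite lerD ?ler_norm// -normrN ler_wpM2r ?ler_norm//.
  by have [_ [? _]] := AB i; rewrite subr_ge0.
have cs : `|c| * \sum_i (B i - A i) <= e / 3.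
  have s0 : 0 <= \sum_i (B i - A i).
    by rewrite sumr_ge0// => i _; have [_ [? _]] := AB i; rewrite subr_ge0.
  move: sc; rewrite ltr_pdivlMr//; have := normr_ge0 c; nra.
have kb : k * (b - a) <= e / 3.
  rewrite /k mulrAC ler_pdivrMr// ler_wpM2l//; lra.
move: fs; rewrite /c in H cs *.
have -> : f b - (K + k) * b - (f a - (K + k) * a) = f b - f a - K * (b - a) - k * (b - a) by ring.
lra.
Qed.

End AbsolutelyContinuous.

(** * Decay criterion, derivative of the norm, half-spaces and rounding error *)

Section Analysis.
Context {R : realType} {N : nat}.
Local Notation mu := (@lebesgue_measure R).
Implicit Types (u v c : 'cV[R]_N) (x : R -> 'cV[R]_N) (g : R -> R).

#[global] Instance lebesgue_ae_filter : Filter (almost_everywhere mu).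
Proof. exact: ae_filter_ringOfSetsType. Qed.

Lemma ac_onS g (a a' b : R) : a <= a' -> ac_on g a b -> ac_on g a' b.
Proof.
move=> aa' acg e e0; have [d d0 gd] := acg e e0; exists d => // n A B AB.
apply: gd => i; have [? [? ?]] := AB i; split=> //; exact: le_trans aa' _.
Qed.

Lemma ac_on_lipschitz g x (C a b : R) : 0 <= C ->
  (forall s t, `|g s - g t| <= C * enorm (x s - x t)) ->
  absolutely_continuous a b x -> ac_on g a b.
Proof.
move=> C0 gx acx e e0.
have C1 : 0 < C + 1 by lra.
have [d d0 xd] := acx _ (divr_gt0 e0 C1).
exists d => // n A B AB tr len.
have := xd n A B AB tr len; rewrite ltr_pdivlMr//; apply: le_lt_trans.
rewrite mulr_suml; apply: ler_sum => i _; apply: le_trans (gx _ _) _.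
have := enorm_ge0 (x (B i) - x (A i)); nra.
Qed.

(** Absolute continuity tested on the single interval []s, b[] gives left continuity at [b]. *)
Lemma ac_on_left_limit g (a b K : R) : a <= b -> ac_on g a b ->
  (forall e, 0 < e -> exists s, [/\ a <= s, s <= b, b - e < s & g s <= K]) -> g b <= K.
Proof.
move=> ab acg gK; apply/ler_addgt0Pr => e e0.
have [d d0 gd] := acg e e0.
have [s [as_ sb ds gs]] := gK d d0.
have bsd : b - s < d by lra.
have : `|g b - g s| < e.
  have := gd 1%N (fun=> s) (fun=> b); rewrite !big_ord1.
  by apply=> // i j _ _ _; rewrite !ord1.
by move=> /(le_lt_trans (ler_norm _)); lra.
Qed.

(** The left endpoint is a null set. It has to be excluded when [a] is the last time at which [g] is
    at most a threshold, since the derivative bound is only known above it. *)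
Lemma ac_on_derive_le_open g (a b K : R) : a <= b -> ac_on g a b ->
  {ae mu, forall t, a < t -> t <= b -> derivable g t 1 /\ derive1 g t <= K} ->
  g b - g a <= K * (b - a).
Proof.
move=> ab acg dg; apply: ac_on_derive_le => //.
have : {ae mu, forall t, t != a}.
  exists [set a]; split; [exact: measurable_set1|exact: lebesgue_measure_set1|].
  by move=> t /= /negP; rewrite negbK => /eqP.
by apply: filterS2 dg => t H ta at_; apply: H; rewrite lt_neqAle eq_sym ta.
Qed.

(** If [g] stayed above [K], its decrease at rate [c] would make it negative. Once at most [K] it
    stays so: after the last time before [t] with [g <= K], the function could only decrease. *)
Lemma ac_on_eventually_le g (K c : R) : 0 < c -> (forall t, 0 <= g t) ->
  (forall b, 0 <= b -> ac_on g 0 b) ->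
  {ae mu, forall t, 0 <= t -> K < g t -> derivable g t 1 /\ derive1 g t <= - c} ->
  exists2 T, 0 <= T & forall t, T <= t -> g t <= K.
Proof.
move=> c0 g0 acg dg.
have drop a b : 0 <= a -> a <= b -> (forall t, a < t -> t <= b -> K < g t) ->
    g b - g a <= - c * (b - a).
  move=> a0 ab Kg; apply: ac_on_derive_le_open => //.
    by apply: (@ac_onS g 0 a b a0); apply: acg; exact: le_trans a0 ab.
  apply: filterS dg => t H at_ tb; apply: H; last exact: Kg.
  by exact: le_trans a0 (ltW at_).
have [T T0 gT] : exists2 T, 0 <= T & g T <= K.
  apply: contrapT => noT.
  have gK t : 0 <= t -> K < g t.
    by move=> t0; rewrite ltNge; apply/negP => gt; apply: noT; exists t.
  (* By this time the forced decrease is [g 0 + 1], more than [g 0]. *)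
  pose b := (g 0 + 1) / c.
  have b0 : 0 <= b by rewrite divr_ge0 ?(ltW c0)// addr_ge0.
  have := drop 0 b (lexx _) b0 (fun t t0 _ => gK t (ltW t0)).
  have cb : c * b = g 0 + 1 by rewrite mulrC divfK ?gt_eqF.
  by rewrite subr0 mulNr cb; have := g0 b; lra.
exists T => // t Tt; rewrite leNgt; apply/negP => Kt.
pose S := [set s | T <= s /\ s <= t /\ g s <= K].
have ST : S T by [].
have ubS : has_ubound S by exists t => s [_ []].
have Ts : T <= sup S by apply: ub_le_sup.
have st : sup S <= t by apply: ge_sup => [|s [_ []]//]; exists T.
have gs : g (sup S) <= K.
  apply: (@ac_on_left_limit g T) => // [|e e0].
    by apply: (@ac_onS g 0 T _ T0); apply: acg; exact: le_trans T0 Ts.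
  have [s Ss es] := sup_adherent e0 (conj (ex_intro _ T ST) ubS).
  have ss : s <= sup S by exact: ub_le_sup.
  by exists s; case: Ss => ? [? ?]; split.
have := drop (sup S) t (le_trans T0 Ts) st.
have H s : sup S < s -> s <= t -> K < g s.
  move=> Ss st'; rewrite ltNge; apply/negP => gsK.
  have : s <= sup S by apply: ub_le_sup => //; split=> //; apply: le_trans Ts (ltW Ss).
  by rewrite leNgt Ss.
move=> /(_ H); nra.
Qed.

Lemma is_derive_dot u x t : derivable x t 1 ->
  is_derive t 1 (fun s => dot u (x s)) (dot u (derive1 x t)).
Proof.
move=> dx; have dxi := (derivable_mxP x t 1).1 dx.
rewrite derive1E (derive_mx dx) dotE.
rewrite (_ : (fun _ => _) = \sum_i (fun s => u i 0 *: (x s i 0 : R^o))); last first.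
  by apply/funext => s; rewrite fct_sumE dotE.
apply: is_derive_sum => i; rewrite mxE.
apply: is_deriveZ; apply/derivableP; exact: dxi.
Qed.

(** The squared norm is differentiated by coordinates and composed with the square root, which is
    differentiable away from zero. *)
Lemma is_derive_enorm x c t : derivable x t 1 -> x t - c != 0 ->
  is_derive t 1 (fun s => enorm (x s - c)) (dot (x t - c) (derive1 x t) / enorm (x t - c)).
Proof.
move=> dx y0; have dxi := (derivable_mxP x t 1).1 dx.
have y1 : 0 < dot (x t - c) (x t - c) by rewrite lt_def dot_eq0 y0 dot_ge0.
have dsq : is_derive t 1 (fun s => dot (x s - c) (x s - c)) (2 * dot (x t - c) (derive1 x t)).
  rewrite derive1E (derive_mx dx) dotE mulr_sumr.
  rewrite (_ : (fun _ => _) = \sum_i (fun s => (x s i 0 - c i 0) ^+ 2)); last first.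
    by apply/funext => s; rewrite fct_sumE dotE; apply: eq_bigr => i _; rewrite !mxE expr2.
  apply: is_derive_sum => i; rewrite !mxE.
  have di : is_derive t 1 (fun s => x s i 0 - c i 0) ('D_1 (fun s => x s i 0) t).
    rewrite -[X in is_derive _ _ _ X]subr0.
    by apply: is_deriveB; apply/derivableP; exact: dxi.
  have := is_deriveX 2 di; congr is_derive.
  by rewrite /GRing.scale /= expr1 mulrA.
have := is_derive1_comp (is_derive1_sqrt y1) dsq.
rewrite (_ : _ \o _ = fun s => enorm (x s - c)); last first.
  by apply/funext => s; rewrite /= enormE.
rewrite -enormE; congr is_derive.
have : enorm (x t - c) != 0 by rewrite enorm_eq0.
by move=> ?; field.
Qed.

(** A half-space is closed and convex, so it contains the closed convex hull of the image of a ball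
    as soon as it contains that image. Letting the radius [d] shrink removes the slack [k * d]. *)
Lemma krasowskii_halfspace (f : 'cV[R]_N -> 'cV[R]_N) (z u v : 'cV[R]_N) (c k : R) : 0 <= k ->
  (forall d y, 0 < d -> enorm (y - z) < d -> dot u (f y) <= c + k * d) ->
  krasowskii f z v -> dot u v <= c.
Proof.
move=> k0 uf zv; apply/ler_addgt0Pr => e e0.
have k1 : 0 < k + 1 by lra.
have d0 : 0 < e / (k + 1) by rewrite divr_gt0.
apply: (@le_trans _ _ (c + k * (e / (k + 1)))); last first.
  by rewrite lerD2l mulrCA ger_pMr// ler_pdivrMr//; lra.
pose H := [set w | dot u w <= c + k * (e / (k + 1))].
suff : H v by [].
have := zv _ d0; apply; split.
  split.
    apply: (@preimage_closed _ _ (dot u) [set r | r <= _]) => [w _|].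
      exact: continuous_dot.
    exact: closed_le.
  move=> w w' l; rewrite !inE /H /= => wH wH'.
  rewrite dotDr !dotZr.
  have l0 : 0 <= l%:num by [].
  have l1 : l%:num <= 1 by [].
  rewrite /unstable.onem; move: (_ + _) wH wH' => b; nra.
by move=> _ [y /= yz <-]; exact: uf.
Qed.

Lemma quantize_dist (D r : R) : 0 < D -> `|quantize D r - r| <= D / 2.
Proof.
move=> D0; rewrite /quantize.
have := floor_itv (r / D + 2^-1).
set k := (Num.floor _)%:~R => /andP[]; rewrite intrD => k1 k2.
rewrite ler_distl.
have rE : r = r / D * D by rewrite divfK// gt_eqF.
rewrite [X in X - _ <= _]rE [X in _ <= X + _]rE.
by apply/andP; split; nra.
Qed.

End Analysis.

(** * Quantized consensus dynamics *)

Section QuantizedConsensus.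
Context {R : realType} {N : nat} (G : wdigraph R N) (D : R).
Hypotheses (hN : (2 <= N)%N) (hconn : weakly_connected G)
  (hbal : weight_balanced G) (hD : 0 < D).
Local Notation L := (laplacian G).
Local Notation l2 := (lambda2 (Sym L)).
Local Notation f := (fun y : 'cV[R]_N => - L *m quantizev D y).
Local Notation r := (opnorm L / l2 * (D / 2) * Num.sqrt N%:R).

Lemma quantizev_dist (z : 'cV[R]_N) : enorm (quantizev D z - z) <= Num.sqrt N%:R * (D / 2).
Proof.
by apply: enorm_le_coord => [|i]; rewrite ?divr_ge0 ?(ltW hD)// !mxE quantize_dist.
Qed.

(** Since [L] kills [ones], [L *m quantizev D w] is [L *m y] plus the image of the error
    [quantizev D w - z]. The first term gives the decay through [l2]; the second is bounded by
    Cauchy-Schwarz and [opnorm L], and the distance from [w] to [z] accounts for the slack. *)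
Lemma krasowskii_decay (a : R) (z v : 'cV[R]_N) :
  dot ones (z - a *: ones) = 0 -> krasowskii f z v ->
  dot (z - a *: ones) v <= - l2 * enorm (z - a *: ones) * (enorm (z - a *: ones) - r).
Proof.
have [l20 l2le] := lambda2_laplacian G hbal hN hconn.
set y := z - _ => y1; have y0 := enorm_ge0 y; have L0 := opnorm_ge0 L.
apply: (@krasowskii_halfspace _ _ _ _ _ _ _ (enorm y * opnorm L)) => [|d w d0 wz].
  exact: mulr_ge0.
have LE : L *m quantizev D w = L *m y + L *m (quantizev D w - z).
  have {1}-> : quantizev D w = y + (quantizev D w - z) + a *: ones.
    by rewrite /y addrAC subrK addrC subrK.
  by rewrite !mulmxDr -scalemxAr laplacian_ones scaler0 addr0.
have gap : enorm (quantizev D w - z) <= Num.sqrt N%:R * (D / 2) + d.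
  rewrite -(subrKA w); apply: le_trans (enormD _ _) _.
  by apply: lerD (quantizev_dist w) (ltW wz).
have cross : - dot y (L *m (quantizev D w - z)) <=
    enorm y * opnorm L * (Num.sqrt N%:R * (D / 2) + d).
  rewrite -dotNr; apply: le_trans (cauchy_schwarz _ _) _; rewrite enormN -mulrA.
  apply: ler_wpM2l => //; apply: le_trans (enorm_mulmx _ _) _; exact: ler_wpM2l.
have diag := l2le y y1; rewrite -enorm_sqr in diag.
rewrite mulNmx dotNr LE dotDr.
have -> : - l2 * enorm y * (enorm y - r) =
    - (l2 * enorm y ^+ 2) + enorm y * opnorm L * (Num.sqrt N%:R * (D / 2)).
  by field; rewrite gt_eqF.
rewrite mulrDr in cross; lra.
Qed.

Lemma krasowskii_dot0 u (z v : 'cV[R]_N) :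
  (forall y, dot u (f y) = 0) -> krasowskii f z v -> dot u v <= 0.
Proof.
by move=> uf; apply: (@krasowskii_halfspace _ _ _ _ _ _ _ 0) => // d y _ _; rewrite uf mul0r addr0.
Qed.

(** * Behaviour along a solution *)

Variable x : R -> 'cV[R]_N.
Hypothesis hx : krasowskii_solution f x.

Lemma solution_dot_le u t : (forall y, dot u (f y) = 0) -> 0 <= t ->
  dot u (x t) <= dot u (x 0).
Proof.
move=> uf t0; have [acx dx] := hx.
have := @ac_on_derive_le _ (fun s => dot u (x s)) 0 t 0 t0.
rewrite mul0r subr_le0; apply.
  apply: (@ac_on_lipschitz _ _ _ x (enorm u)); [exact: enorm_ge0| |exact: acx].
  move=> s s'; rewrite -dotBr ler_norml lerNl -dotNr.
  by rewrite -{1}(enormN (x s - x s')) !cauchy_schwarz.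
apply: filterS dx => s H s0 _; have [dxs Kx] := H s0.
have ddot := is_derive_dot u x s dxs.
by split; [exact: ex_derive|rewrite derive1E derive_val; exact: krasowskii_dot0 Kx].
Qed.

(** The monotonicity of [solution_dot_le] is used for both [ones] and [- ones]. *)
Lemma solution_average t : 0 <= t -> average (x t) = average (x 0).
Proof.
move=> t0.
have ones0 y : dot ones (f y) = 0 by rewrite mulNmx dotNr dot_ones_laplacian// oppr0.
rewrite /average -!/(dot _ _); congr (_ * _); apply/eqP.
rewrite eq_le solution_dot_le//= -lerN2.
have dotNl (u w : 'cV[R]_N) : - dot u w = dot (- u) w by rewrite dotC -dotNr dotC.
by rewrite !dotNl solution_dot_le// => y; rewrite -dotNl ones0 oppr0.
Qed.

Local Notation c := (average (x 0) *: ones).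

Lemma solution_dot_ones t : 0 <= t -> dot ones (x t - c) = 0.
Proof.
move=> t0; rewrite dotBr dotZr -(solution_average _ t0) /average -/(dot _ _).
have -> : dot ones (ones : 'cV[R]_N) = N%:R.
  by rewrite dotE (eq_bigr (fun=> 1)) => [|i _]; rewrite ?sumr_const ?card_ord// !mxE mulr1.
by rewrite mulrAC mulVf ?mul1r ?subrr// pnatr_eq0 -lt0n (ltn_trans _ hN).
Qed.

Lemma radius_ge0 : 0 <= r.
Proof.
have [l20 _] := lambda2_laplacian G hbal hN hconn.
by rewrite mulr_ge0 ?sqrtr_ge0// mulr_ge0 ?divr_ge0 ?opnorm_ge0 ?(ltW l20) ?(ltW hD).
Qed.

Lemma solution_eventually_near (e : R) : 0 < e ->
  exists2 T, 0 <= T & forall t, T <= t -> enorm (x t - c) <= r + e.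
Proof.
move=> e0; have [l20 _] := lambda2_laplacian G hbal hN hconn.
have [acx dx] := hx; have r0 := radius_ge0.
apply: (@ac_on_eventually_le _ (fun t => enorm (x t - c)) _ (l2 * e)).
- exact: mulr_gt0.
- by move=> t; exact: enorm_ge0.
- move=> b b0; apply: (@ac_on_lipschitz _ _ _ x 1) => //; last exact: acx.
  move=> s t; rewrite mul1r; apply: le_trans (enorm_distl _ _) _.
  by rewrite opprB addrA subrK.
apply: filterS dx => t H t0 rt; have [dxt Kx] := H t0.
have y0 : 0 < enorm (x t - c) by apply: le_lt_trans rt; lra.
have yne : x t - c != 0 by rewrite -enorm_eq0 gt_eqF.
have dnorm := is_derive_enorm x c t dxt yne.
split; first exact: ex_derive.
(* After multiplication by the norm, the required rate [l2 * e] follows from the decay estimate, as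
   the norm exceeds [r] by more than [e]. *)
rewrite derive1E derive_val ler_pdivrMr//.
apply: le_trans (krasowskii_decay _ _ _ (solution_dot_ones _ t0) Kx) _.
have rate (l p q : R) : 0 < l -> 0 < p -> e <= q -> - l * p * q <= - (l * e) * p.
  move=> l0 p0 eq; rewrite !mulNr lerN2 [leLHS]mulrAC.
  by apply: ler_wpM2l => //; exact: mulr_ge0 (ltW l0) (ltW p0).
by apply: rate => //; lra.
Qed.

Lemma edistance_consensus (z : 'cV[R]_N) (e : R) : 0 <= e ->
  enorm (z - c) <= r + e ->
  0 <= edistance z (consensus_set L D (x 0)) <= e.
Proof.
move=> e0 ze; have r0 := radius_ge0.
have sN : 0 < Num.sqrt N%:R :> R by rewrite sqrtr_gt0 ltr0n (ltn_trans _ hN).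
pose S := [set enorm (z - w) | w in consensus_set L D (x 0)].
have inM w : enorm (w - c) <= r -> consensus_set L D (x 0) w.
  by move=> wr; rewrite /consensus_set /= ler_pdivrMl// mulrC.
have S0 : lbound S 0 by move=> _ [w _ <-]; exact: enorm_ge0.
apply/andP; split.
  (* The center [c] shows that the set of distances is nonempty, so that its infimum is
     meaningful. *)
  apply: lb_le_inf => //; exists (enorm (z - c)), c => //.
  by apply: inM; rewrite subrr enorm0.
have [w wM we] : exists2 w, consensus_set L D (x 0) w & enorm (z - w) <= e.
  have [zr|rz] := leP (enorm (z - c)) r.
    by exists z; [exact: inM|rewrite subrr enorm0].
  have y0 : 0 < enorm (z - c) by exact: le_lt_trans rz.
  (* This is the radial projection of [z] onto the sphere of radius [r] around [c], at distance
     [enorm (z - c) - r] from [z]. *)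
  exists (c + (r / enorm (z - c)) *: (z - c)).
    apply: inM; rewrite addrAC subrr add0r enormZ ger0_norm ?divr_ge0 ?enorm_ge0//.
    by rewrite divfK// gt_eqF.
  rewrite opprD addrA -{1}[z - c]scale1r -scalerBl enormZ ger0_norm.
    by rewrite mulrBl mul1r divfK ?gt_eqF//; lra.
  by rewrite subr_ge0 ler_pdivrMr// mul1r ltW.
by apply: le_trans we; apply: ge_inf; [exists 0|exists w].
Qed.

End QuantizedConsensus.

Theorem theorem1 (R : realType) (N : nat) (hN : (2 <= N)%N)
    (G : wdigraph R N) (hconn : weakly_connected G) (hbal : weight_balanced G)
    (D : R) (hD : 0 < D) (x : R -> 'cV[R]_N)
    (hx : krasowskii_solution
            (fun y => - laplacian G *m quantizev D y) x) :
  edistance (x t) (consensus_set (laplacian G) D (x 0)) @[t --> +oo] --> (0 : R).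
Proof.
apply/cvgrPdist_le => e e0.
have [T T0 near_r] := solution_eventually_near G D hN hconn hbal hD x hx e e0.
near=> t.
have Tt : T <= t by near: t; apply: nbhs_pinfty_ge; exact: num_real.
have /andP[d0 de] := edistance_consensus G D hN hconn hbal hD x (x t) e (ltW e0) (near_r t Tt).
by rewrite sub0r normrN ger0_norm.
Unshelve. all: by end_near.
Qed.
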